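(* Let $0<p\leq1$ and let $\mathcal{M}$ be a $p$-metric space. Suppose $\mathcal{N}_{1}$ and $\mathcal{N}_{2}$ are nets in $\mathcal{M}$ of the same cardinality, equal to $\operatorname{dens}\mathcal{M}$. Then $\mathcal{F}_{p}(\mathcal{N}_{1})\simeq\mathcal{F}_{p}(\mathcal{N}_{2})$.
   Context: Let $0<p\le 1$. A $p$-metric on a set $\mathcal{M}$ is a symmetric map $d\colon\mathcal{M}\times\mathcal{M}\to[0,\infty)$ with $d(x,y)=0$ iff $x=y$ and $d^p(x,y)\le d^p(x,z)+d^p(z,y)$ for all $x,y,z$. A $p$-Banach space is a complete real vector space with a $p$-norm, i.e. a quasi-norm with $\|x+y\|^p\le\|x\|^p+\|y\|^p$. For a $p$-metric space $\mathcal{M}$ with base point $0$, the Lipschitz free $p$-space $\mathcal{F}_p(\mathcal{M})$ is the $p$-Banach space, unique up to linear isometry, with an isometric embedding $\delta_{\mathcal{M}}\colon\mathcal{M}\to\mathcal{F}_p(\mathcal{M})$, $\delta_{\mathcal{M}}(0)=0$, such that for every $p$-Banach space $X$ and every Lipschitz map $f\colon\mathcal{M}\to X$ with $f(0)=0$ there is a unique bounded linear map $T_f\colon\mathcal{F}_p(\mathcal{M})\to X$ with $T_f\circ\delta_{\mathcal{M}}=f$, and $\|T_f\|=\mathrm{Lip}(f)$. The linear span of $\delta_{\mathcal{M}}(\mathcal{M})$ is dense in $\mathcal{F}_p(\mathcal{M})$. Changing the base point yields a linearly isometric space. A subset $\mathcal{N}$ of $(\mathcal{M},d)$ is a net if $\inf\{d(x,y)\colon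 x,y\in\mathcal{N},\,x\neq y\}>0$ and $\sup_{x\in\mathcal{M}}d(x,\mathcal{N})<\infty$. $\operatorname{dens}\mathcal{M}$ is the minimal cardinality of a dense subset of $\mathcal{M}$. $\simeq$ denotes linear isomorphism. *)

(* Defs.v *)
From HB Require Import structures.
From mathcomp Require Import all_boot all_order all_algebra.
From mathcomp Require Import all_classical all_reals all_analysis.

Set Implicit Arguments.
Unset Strict Implicit.
Unset Printing Implicit Defensive.

Import Order.TTheory GRing.Theory Num.Theory.
Import numFieldNormedType.Exports.

Local Open Scope classical_set_scope.
Local Open Scope card_scope.
Local Open Scope ring_scope.

Section Metric.
Context {R : realType}.

Record is_pmetric (p : R) (M : Type) (d : M -> M -> R) : Prop := IsPMetric {
  pmetric_ge0 : forall x y, 0 <= d x y;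
  pmetric_sym : forall x y, d x y = d y x;
  pmetric_eq0 : forall x y, d x y = 0 <-> x = y;
  pmetric_triangle : forall x y z, d x y `^ p <= d x z `^ p + d z y `^ p
}.

Definition subdist (M : Type) (d : M -> M -> R) (A : set M) (x y : A) : R :=
  d (\val x) (\val y).

Lemma subdist_pmetric (p : R) (M : Type) (d : M -> M -> R) (A : set M) :
  is_pmetric p d -> is_pmetric p (subdist d (A := A)).
Proof.
case=> d0 dC d_eq0 dD; split=> [x y|x y|x y|x y z]; rewrite /subdist //.
by split=> [/d_eq0/val_inj //|->]; apply/d_eq0.
Qed.

(* The infima and the supremum are taken in the extended reals, so that
   inf set0 = +oo: a one-point set is separated, and every point of M is at
   distance +oo from the empty set. *)
Definition separation (M : Type) (d : M -> M -> R) (N : set M) : \bar R :=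
  ereal_inf [set (d z.1 z.2)%:E | z in [set z | [/\ N z.1, N z.2 & z.1 <> z.2]]].

Definition dist_to_set (M : Type) (d : M -> M -> R) (x : M) (N : set M) :
    \bar R :=
  ereal_inf [set (d x y)%:E | y in N].

Definition is_net (M : Type) (d : M -> M -> R) (N : set M) : Prop :=
  (0 < separation d N)%E /\
  (ereal_sup (range (fun x => dist_to_set d x N)) < +oo)%E.

Definition metric_dense (M : Type) (d : M -> M -> R) (D : set M) : Prop :=
  forall x e, 0 < e -> exists2 y, D y & d x y < e.

(* card A = dens M, the minimal cardinality of a dense subset of M. *)
Definition card_is_dens (M : Type) (d : M -> M -> R) (A : set M) : Prop :=
  (exists2 D, metric_dense d D & D #= A) /\
  (forall D, metric_dense d D -> A #<= D).

End Metric.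

Section Spaces.
Context {R : realType}.

Record is_quasinorm (X : lmodType R) (N : X -> R) : Prop := IsQuasinorm {
  quasinorm_ge0 : forall x, 0 <= N x;
  quasinorm_eq0 : forall x, N x = 0 <-> x = 0;
  quasinormZ : forall (a : R) x, N (a *: x) = `|a| * N x;
  quasinormD : exists k : R, forall x y, N (x + y) <= k * (N x + N y)
}.

Record is_pnorm (p : R) (X : lmodType R) (N : X -> R) : Prop := IsPNorm {
  pnorm_quasinorm : is_quasinorm N;
  pnorm_triangle : forall x y, N (x + y) `^ p <= N x `^ p + N y `^ p
}.

Definition norm_complete (X : lmodType R) (N : X -> R) : Prop :=
  forall u : nat -> X,
    (forall e : R, 0 < e -> \forall m & n \near \oo, N (u m - u n) < e) ->
    exists l : X, N (u n - l) @[n --> \oo] --> (0 : R).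

Definition is_pbanach (p : R) (X : lmodType R) (N : X -> R) : Prop :=
  is_pnorm p N /\ norm_complete N.

Definition lipschitz_map (M : Type) (d : M -> M -> R) (X : lmodType R)
    (N : X -> R) (f : M -> X) : Prop :=
  exists L : R, forall x y, N (f x - f y) <= L * d x y.

(* This sup is real-valued: it is meaningful only for Lipschitz f, and it is 0
   on a one-point space since sup set0 = 0. *)
Definition lip_const (M : Type) (d : M -> M -> R) (X : lmodType R)
    (N : X -> R) (f : M -> X) : R :=
  sup [set N (f z.1 - f z.2) / d z.1 z.2 | z in [set z | z.1 <> z.2]].

Definition bounded_map (X Y : lmodType R) (NX : X -> R) (NY : Y -> R)
    (T : X -> Y) : Prop :=
  exists C : R, forall x, NY (T x) <= C * NX x.

(* As for lip_const, meaningful only for bounded T. *)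
Definition op_norm (X Y : lmodType R) (NX : X -> R) (NY : Y -> R)
    (T : X -> Y) : R :=
  sup [set NY (T x) | x in [set x | NX x <= 1]].

(* (F, NF), together with delta, is the Lipschitz free p-space of the p-metric
   space (M, d) with base point o. *)
Record is_lipschitz_free (p : R) (M : Type) (d : M -> M -> R) (o : M)
    (F : lmodType R) (NF : F -> R) (delta : M -> F) : Prop := IsLipschitzFree {
  free_pbanach : is_pbanach p NF;
  free_base : delta o = 0;
  free_isometry : forall x y, NF (delta x - delta y) = d x y;
  free_universal : forall (X : lmodType R) (NX : X -> R), is_pbanach p NX ->
    forall f : M -> X, lipschitz_map d NX f -> f o = 0 ->
    exists T : {linear F -> X},
      [/\ bounded_map NF NX T,
          forall x, T (delta x) = f x,
          op_norm NF NX T = lip_const d NX f &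
          forall T' : {linear F -> X}, bounded_map NF NX T' ->
            (forall x, T' (delta x) = f x) -> forall v, T' v = T v]
}.

Definition linearly_isomorphic (X Y : lmodType R) (NX : X -> R) (NY : Y -> R) :
    Prop :=
  exists (T : {linear X -> Y}) (S : {linear Y -> X}),
    [/\ bounded_map NX NY T, bounded_map NY NX S, cancel T S & cancel S T].

End Spaces.

(* Main.v *)
Require Import Defs.
From HB Require Import structures.
From mathcomp Require Import all_boot all_order all_algebra.
From mathcomp Require Import all_classical all_reals all_analysis.

Set Implicit Arguments.
Unset Strict Implicit.
Unset Printing Implicit Defensive.

Import Order.TTheory GRing.Theory Num.Theory.
Import numFieldNormedType.Exports.

(** Two nets of the same space differ by a bounded displacement of points, and
on uniformly separated sets such a displacement only costs an l_p summand.
Choose for each y in N2 a point g y of N1 at bounded distance, and for each x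
in N1 a point h x of N2 at bounded distance.  Adjoin to F(N1) independent unit
vectors e_y (y in N2), where e_y stands for delta y - delta (g y): the space
F(N1) x l_p(N2) models the free space of the disjoint union of the two nets.
So does F(N2) x l_p(N1), hence both are isomorphic.  On generators the
isomorphism sends delta x to (delta (h x), e_x) and e_y to
(delta y, 0) - (delta (h (g y)), e_(g y)), up to constants that account for the
base points; the formula for its inverse is the same with the nets exchanged
([cross_exists], [cross_cancel]).

If the nets are infinite, the l_p summands disappear because
F(N) is isomorphic to F(N) x l_p(N) ([free_absorb]).  Indeed let r x > 0 be the
distance from x to the rest of N and let y x be a point that almost realises
it.  A map f with |f x| <= C r x is automatically Lipschitz.  So if A is a set
of points x such that no y x is in A, the values of a Lipschitz map at the
points of A can be prescribed freely up to the scale r, while it vanishes off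
A; this says that the vectors (delta x - delta (y x)) / r x, x in A, span a
complemented copy of l_p(A) ([free_lp_complement]).  Since y has no fixed point,
A can be taken of the same cardinality as N ([injective_independent]).  As N is
infinite, N + N is equipotent to N ([bijective_sum_infinite]), so this
complemented copy is isomorphic to its square and absorbs one more copy of
itself.

Spaces of type l_p are handled through their universal property
([is_lp_basis]): a bounded family of vectors extends uniquely to a bounded
operator.  The only instances needed are ranges of projections in free spaces.

Finite nets of the same cardinality are bi-Lipschitz equivalent through any
bijection. *)

Local Open Scope classical_set_scope.
Local Open Scope card_scope.
Local Open Scope ring_scope.

(** * Infinite cardinals *)

Lemma card_le_inj (T U : Type) :
  [set: T] #<= [set: U] <-> exists f : T -> U, injective f.
Proof.
split=> [/card_leP[f]|[f injf]].
  have fT (x : T) : x \in [set: T] by exact: mem_set.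
  exists (fun x => \val (f (SigSub (fT x)))) => x y /val_inj e.
  have /(congr1 val) // : SigSub (fT x) = SigSub (fT y).
  by apply: (inj (f := f)) => //; exact: mem_set.
have injf' : set_inj [set: T] f by move=> x y _ _ /injf.
have /injfunPex[g] :
    exists2 f : T -> U, set_fun [set: T] [set: U] f & set_inj [set: T] f.
  by exists f.
exact: inj_card_le g.
Qed.

Lemma infinite_seq (T : Type) (A : set T) : infinite_set A ->
  exists2 u : nat -> T, injective u & range u `<=` A.
Proof.
move=> /infiniteP; rewrite (card_le_eqr (card_setT_sym A)) => /card_le_inj[f injf].
exists (fun n => \val (f n)) => [m n /val_inj/injf //|_ [n _ <-]].
exact: set_valP.
Qed.

(** A maximal family E of pairwise disjoint injective sequences leaves out a
finite set only, so that T embeds in E x nat: the points of the sequences use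
the even indices, the remaining points the odd indices of one fixed sequence.
Splitting nat once more into even and odd numbers makes room for T + T. *)
Lemma injective_sum_infinite (T : Type) :
  infinite_set [set: T] -> exists f : T + T -> T, injective f.
Proof.
move=> infT.
have [E [Einj Etriv Emax]] := ex_maximal_disjoint_subcollection
  (fun u : nat -> T => range u) [set u | injective u].
pose U := \bigcup_(u in E) range u.
have finU : finite_set (~` U).
  apply: contrapT => /infinite_seq[u uinj uU].
  apply: (Emax (E `|` [set u])).
  - split=> [v Ev|sub]; first by left.
    by apply: (uU (u 0%N)); [exists 0%N|exists u;
      [exact: sub (or_intror _)|exists 0%N]].
  - by move=> v [/Einj //|->].
  - move=> v w [Ev|->] [Ew|->] //; first exact: Etriv.
    + by case=> x [vx ux]; case: (uU _ ux); exists v.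
    + by case=> x [ux vx]; case: (uU _ ux); exists w.
have /countable_injP[c cinj] := finite_set_countable finU.
have [u0 Eu0] : exists u, E u.
  apply: contrapT => E0; apply: infT; apply: sub_finite_set finU => x _ [u Eu _].
  by apply: E0; exists u.
(* k x is the address of x in E x nat. *)
have /choice[k kP] (x : T) : exists k : (nat -> T) * nat, E k.1 /\
    (U x /\ (exists2 n, x = k.1 n & k.2 = n.*2)
     \/ ~ U x /\ (k.1 = u0 /\ k.2 = (c x).*2.+1)).
  have [[u Eu [n _ unx]]|nUx] := pselect (U x).
    exists (u, n.*2); split=> //; left; split; first by exists u => //; exists n.
    by exists n.
  by exists (u0, (c x).*2.+1); split=> //; right.
have kinj : injective k.
  move=> x y exy; case: (kP x) (kP y); rewrite exy => _.
  case=> -[Ux]; case.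
    move=> n xn kn [_ [[Uy [m ym km]]|[_ [_ km]]]].
      by rewrite [LHS]xn [RHS]ym; congr (_ _); apply: double_inj; rewrite -kn.
    by have := congr1 odd kn; rewrite km /= !odd_double.
  move=> _ kx [_ [[Uy [m ym km]]|[Uy [_ ky]]]].
    by have := congr1 odd kx; rewrite km /= !odd_double.
  apply: cinj; [exact: mem_set|exact: mem_set|].
  by apply: double_inj; apply: succn_inj; rewrite -kx -ky.
pose h (z : T + T) := match z with
  | inl x => (k x).1 (k x).2.*2 | inr x => (k x).1 (k x).2.*2.+1 end.
have hE x y m n : (k x).1 m = (k y).1 n -> (k x).1 = (k y).1 /\ m = n.
  move=> e; have e1 : (k x).1 = (k y).1.
    apply: Etriv; [exact: (kP x).1|exact: (kP y).1|].
    by exists ((k x).1 m); split; [exists m|rewrite e; exists n].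
  by split=> //; apply: (Einj _ (kP x).1); rewrite e e1.
exists h => -[x|x] [y|y] /= /hE[e1] e2.
- congr inl; apply: kinj; case: (k x) (k y) e1 e2 => [a b] [a' b'] /= ->.
  by move/double_inj => ->.
- by have := congr1 odd e2; rewrite /= !odd_double.
- by have := congr1 odd e2; rewrite /= !odd_double.
- congr inr; apply: kinj; case: (k x) (k y) e1 e2 => [a b] [a' b'] /= -> [].
  by move/double_inj => ->.
Qed.

Lemma bijective_sum_infinite (T : Type) :
  infinite_set [set: T] -> exists f : T + T -> T, bijective f.
Proof.
move=> /injective_sum_infinite fP.
have /card_bijP[f] : [set: T + T] #= [set: T].
  apply: Cantor_Bernstein; first exact/card_le_inj.
  by apply/card_le_inj; exists inl => x y [].
have inT z : z \in [set: T + T] by exact: mem_set.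
case=> g gK fK.
exists (fun z => \val (f (SigSub (inT z)))).
exists (fun x => \val (g (SigSub (mem_set (I : [set: T] x))))) => [z|x].
  rewrite (_ : SigSub _ = f (SigSub (inT z))); first by rewrite gK.
  exact: val_inj.
rewrite (_ : SigSub _ = g (SigSub (mem_set (I : [set: T] x)))) ?fK //.
exact: val_inj.
Qed.

(** Comparability of cardinals: a maximal partial bijection between T and U
exhausts T or U. *)
Lemma injective_total (T U : Type) :
  (exists f : T -> U, injective f) \/ (exists f : U -> T, injective f).
Proof.
pose P (G : set (T * U)) := forall a b, G a -> G b -> (a.1 = b.1 <-> a.2 = b.2).
have [|G [PG Gmax]] := @Zorn_bigcup _ P.
  move=> F FP Ftot a b [X FX Xa] [Y FY Yb].
  have [XY|YX] := Ftot _ _ FX FY; first exact: (FP _ FY _ _ (XY _ Xa)).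
  exact: (FP _ FX _ _ _ (YX _ Yb)).
have [domG|] := pselect (forall x, exists y, G (x, y)).
  left; have /choice[f fG] := domG; exists f => x y e.
  by apply/(PG _ _ (fG x) (fG y)).
move=> /existsNP[x /forallNP xG]; right.
have /choice[f fG] (y : U) : exists x, G (x, y).
  apply: contrapT => /forallNP yG; apply: (Gmax (G `|` [set (x, y)])).
    split=> [a Ga|sub]; first by left.
    by apply: (xG y); apply: sub; right.
  move=> [a b] [a' b'] [Gab|[-> ->]] [Gab'|[-> ->]] //=;
    first exact: (PG (a, b) (a', b')).
  - by split=> e; [case: (xG b); rewrite -e|case: (yG a); rewrite -e].
  - by split=> e; [case: (xG b'); rewrite e|case: (yG a'); rewrite e].
by exists f => y z e; apply/(PG _ _ (fG y) (fG z)).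
Qed.

(** Adding to B two sets that embed in B does not increase its cardinality
when the total is infinite. *)
Lemma injective_cover3 (T : Type) (A B C : set T) (i : A -> B) (j : C -> B) :
  infinite_set [set: T] -> (forall x, [\/ A x, B x | C x]) ->
  injective i -> injective j ->
  exists2 f : T -> T, injective f & forall x, B (f x).
Proof.
move=> infT cov injI injj.
have infB : infinite_set [set: B].
  move=> finB; apply: infT; have finA : finite_set A.
    rewrite -(eq_finite_set (card_setT A)); apply: card_le_finite finB.
    by apply/card_le_inj; exists i.
  have finC : finite_set C.
    rewrite -(eq_finite_set (card_setT C)); apply: card_le_finite finB.
    by apply/card_le_inj; exists j.
  rewrite (eq_finite_set (card_setT B)) in finB.
  apply: (@sub_finite_set _ _ (A `|` B `|` C)); last by rewrite !finite_setU.
  by move=> x _; have [?|?|?] := cov x; [left; left|left; right|right].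
have [s injs] := injective_sum_infinite infB.
have /choice[k kP] (x : T) : exists z : (B + B) + B,
    match z with
    | inl (inl b) => exists a : A, x = \val a /\ b = i a
    | inl (inr b) => x = \val b
    | inr b => exists a : C, x = \val a /\ b = j a end.
  have [Ax|Bx|Cx] := cov x.
  - by exists (inl (inl (i (SigSub (mem_set Ax))))); exists (SigSub (mem_set Ax)).
  - by exists (inl (inr (SigSub (mem_set Bx)))).
  - by exists (inr (j (SigSub (mem_set Cx)))); exists (SigSub (mem_set Cx)).
have kinj : injective k.
  move=> x y e; move: (kP x) (kP y); rewrite e; case: (k y) => [[b|b]|b].
  - by move=> [a [-> ->]] [a' [-> /injI ->]].
  - by move=> -> ->.
  - by move=> [a [-> ->]] [a' [-> /injj ->]].
pose t (z : (B + B) + B) : B :=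
  match z with inl w => s (inl (s w)) | inr b => s (inr b) end.
exists (fun x => \val (t (k x))) => [x y /val_inj e|x]; last exact: set_valP.
apply: kinj; move: e; rewrite /t.
by case: (k x) (k y) => [w|b] [w'|b'] /injs // [] => [/injs ->|->].
Qed.

(** A maximal set A such that y(A) avoids A satisfies
T = A `|` y^-1(A) `|` y(A).  The preimage y^-1(A) is also mapped by y outside
itself, y(A) is not larger than A, and one of A, y^-1(A) dominates the other: it
has the cardinality of T. *)
Lemma injective_independent (T : Type) (y : T -> T) :
  infinite_set [set: T] -> (forall x, y x <> x) ->
  exists2 b : T -> T, injective b & forall s t, y (b s) <> b t.
Proof.
move=> infT yN.
pose P (A : set T) := forall a b, A a -> A b -> y a <> b.
have [|A [PA Amax]] := @Zorn_bigcup _ P.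
  move=> F FP Ftot a b [X FX Xa] [Y FY Yb].
  have [XY|YX] := Ftot _ _ FX FY; first exact: (FP _ FY _ _ (XY _ Xa)).
  exact: (FP _ FX _ _ _ (YX _ Yb)).
pose B := [set x | A (y x)].
pose C := y @` A.
have cov x : [\/ A x, B x | C x].
  apply: contrapT => ncov.
  have [nA nB nC] : [/\ ~ A x, ~ B x & ~ C x].
    by split=> h; apply: ncov; [apply: Or31|apply: Or32|apply: Or33].
  apply: (Amax (A `|` [set x])).
    by split=> [a|sub]; [left|apply: nA; apply: sub; right].
  move=> a b [Aa|->] [Ab|->] //; first exact: PA.
  - by move=> e; apply: nC; exists a.
  - by move=> e; apply: nB; rewrite /B /= e.
have [k kinj] : exists k : C -> A, injective k.
  have /choice[k kP] (c : C) : exists a : A, y (\val a) = \val c.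
    have [a Aa e] : C (\val c) by exact: set_valP.
    by exists (SigSub (mem_set Aa)).
  by exists k => c c' e; apply: val_inj; rewrite -!kP e.
have [[i iinj]|[i iinj]] := injective_total A B.
  have [f finj fB] := injective_cover3 infT cov iinj (inj_comp iinj kinj).
  exists f => // s t e; have := fB s; rewrite /B /= e => At.
  exact: PA At (fB t) _.
have [|f finj fA] := @injective_cover3 _ B A C i k infT _ iinj kinj.
  by move=> x; have [?|?|?] := cov x; [apply: Or32|apply: Or31|apply: Or33].
by exists f => // s t; apply: PA.
Qed.

(** * Bounded linear maps *)
Section BoundedLinear.
Context {R : realType}.
Implicit Types (p : R) (X Y Z : lmodType R).

Lemma quasinormN X (N : X -> R) (x : X) : is_quasinorm N -> N (- x) = N x.
Proof. by move=> hN; rewrite -scaleN1r (quasinormZ hN) normrN1 mul1r. Qed.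

Lemma quasinorm0 X (N : X -> R) : is_quasinorm N -> N 0 = 0.
Proof. by move=> hN; apply/(quasinorm_eq0 hN). Qed.

(** The form in which the quasi-triangle inequality is used: one nonnegative
constant that works for sums and differences. *)
Lemma quasinorm_leD X (N : X -> R) : is_quasinorm N ->
  exists2 k : R, 0 <= k & forall x y a b, N x <= a -> N y <= b ->
    N (x + y) <= k * (a + b) /\ N (x - y) <= k * (a + b).
Proof.
move=> hN; have [k kP] := quasinormD hN.
have N0 := quasinorm_ge0 hN.
exists `|k| => // x y a b xa yb.
have le z t : N (z + t) <= `|k| * (N z + N t).
  by apply: le_trans (kP z t) _; rewrite ler_wpM2r ?ler_norm// addr_ge0.
split; apply: le_trans (le _ _) _; rewrite ?quasinormN //;
by rewrite ler_wpM2l ?lerD.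
Qed.

(** Operators are kept as plain functions, since they are mostly given by
formulas; [bounded_linear_bundle] turns them into bundled linear maps. *)
Record bounded_linear X Y (NX : X -> R) (NY : Y -> R) (f : X -> Y) : Prop :=
  BoundedLinear { bounded_linearP : linear f;
                  bounded_linear_le : bounded_map NX NY f }.

Section Theory.
Context X Y (NX : X -> R) (NY : Y -> R).
Hypotheses (hX : is_quasinorm NX) (hY : is_quasinorm NY).

Lemma bounded_linear_sub (f : X -> Y) : bounded_linear NX NY f ->
  {morph f : u v / u - v}.
Proof.
by move=> [lf _] u v; rewrite [u - v]addrC -scaleN1r lf scaleN1r addrC.
Qed.

Lemma bounded_linear0 (f : X -> Y) : bounded_linear NX NY f -> f 0 = 0.
Proof. by move=> hf; rewrite -(subrr 0) (bounded_linear_sub hf) subrr. Qed.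

Lemma bounded_linear_add (f : X -> Y) : bounded_linear NX NY f ->
  {morph f : u v / u + v}.
Proof. by move=> [lf _] u v; rewrite -[u]scale1r lf !scale1r. Qed.

Lemma bounded_linear_scale (f : X -> Y) a : bounded_linear NX NY f ->
  {morph f : u / a *: u}.
Proof.
move=> hf u.
by rewrite -[a *: u]addr0 (bounded_linearP hf) (bounded_linear0 hf) addr0.
Qed.

Lemma bounded_linear_bound (f : X -> Y) : bounded_linear NX NY f ->
  exists2 C, 0 <= C & forall x, NY (f x) <= C * NX x.
Proof.
move=> [_ [C hC]]; exists `|C| => // x; apply: le_trans (hC x) _.
by rewrite ler_wpM2r ?ler_norm // (quasinorm_ge0 hX).
Qed.

Lemma bounded_linear_linear (T : {linear X -> Y}) :
  bounded_map NX NY T -> bounded_linear NX NY T.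
Proof. by move=> hT; split=> // a u v; rewrite linearP. Qed.

Lemma bounded_linear_bundle (f : X -> Y) : bounded_linear NX NY f ->
  exists2 T : {linear X -> Y}, bounded_map NX NY T & T =1 f.
Proof.
move=> [lf bf].
pose m := GRing.isLinear.Build R X Y *:%R f lf.
pose T : {linear X -> Y} := HB.pack f m.
by exists T.
Qed.

Lemma bounded_linear_id : bounded_linear NX NX id.
Proof. by split=> //; exists 1 => x; rewrite mul1r. Qed.

Lemma bounded_linear_zero : bounded_linear NX NY (fun=> 0).
Proof.
split=> [a u v|]; first by rewrite scaler0 addr0.
by exists 0 => x; rewrite mul0r quasinorm0.
Qed.

Lemma bounded_linear_add_fun (f g : X -> Y) :
  bounded_linear NX NY f -> bounded_linear NX NY g ->
  bounded_linear NX NY (fun x => f x + g x).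
Proof.
move=> hf hg; have [k k0 kP] := quasinorm_leD hY.
have [C C0 hC] := bounded_linear_bound hf.
have [D D0 hD] := bounded_linear_bound hg.
split=> [a u v|].
  by rewrite (bounded_linearP hf) (bounded_linearP hg) scalerDr addrACA.
exists (k * (C + D)) => x; rewrite -mulrA mulrDl.
by have [] := kP _ _ _ _ (hC x) (hD x).
Qed.

Lemma bounded_linear_sub_fun (f g : X -> Y) :
  bounded_linear NX NY f -> bounded_linear NX NY g ->
  bounded_linear NX NY (fun x => f x - g x).
Proof.
move=> hf [lg [C hC]]; apply: bounded_linear_add_fun => //; split.
  by move=> a u v; rewrite lg opprD scalerN.
by exists C => x; rewrite quasinormN.
Qed.

End Theory.

Lemma bounded_linear_comp X Y Z (NX : X -> R) (NY : Y -> R) (NZ : Z -> R)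
    (f : X -> Y) (g : Y -> Z) : is_quasinorm NX -> is_quasinorm NY ->
  bounded_linear NX NY f -> bounded_linear NY NZ g ->
  bounded_linear NX NZ (fun x => g (f x)).
Proof.
move=> hX hY hf hg.
have [C C0 hC] := bounded_linear_bound hX hf.
have [D D0 hD] := bounded_linear_bound hY hg.
split=> [a u v|]; first by rewrite (bounded_linearP hf) (bounded_linearP hg).
exists (D * C) => x; apply: le_trans (hD _) _.
by rewrite -mulrA ler_wpM2l.
Qed.

Lemma linearly_isomorphicI X Y (NX : X -> R) (NY : Y -> R) (f : X -> Y)
    (g : Y -> X) : bounded_linear NX NY f -> bounded_linear NY NX g ->
  cancel f g -> cancel g f -> linearly_isomorphic NX NY.
Proof.
move=> /bounded_linear_bundle[T bT Tf] /bounded_linear_bundle[S bS Sg] fK gK.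
by exists T, S; split=> // x; rewrite Tf Sg.
Qed.

Lemma linearly_isomorphicE X Y (NX : X -> R) (NY : Y -> R) :
  linearly_isomorphic NX NY -> exists f g,
  [/\ bounded_linear NX NY f, bounded_linear NY NX g, cancel f g & cancel g f].
Proof.
by move=> [T [S [bT bS TK SK]]]; exists T, S; split=> //; exact: bounded_linear_linear.
Qed.

Lemma linearly_isomorphic_sym X Y (NX : X -> R) (NY : Y -> R) :
  linearly_isomorphic NX NY -> linearly_isomorphic NY NX.
Proof. by move=> [T [S [bT bS TK SK]]]; exists S, T. Qed.

Lemma linearly_isomorphic_trans X Y Z (NX : X -> R) (NY : Y -> R)
    (NZ : Z -> R) : is_quasinorm NX -> is_quasinorm NY -> is_quasinorm NZ ->
  linearly_isomorphic NX NY -> linearly_isomorphic NY NZ ->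
  linearly_isomorphic NX NZ.
Proof.
move=> hX hY hZ /linearly_isomorphicE[f [f' [bf bf' fK f'K]]].
move=> /linearly_isomorphicE[g [g' [bg bg' gK g'K]]].
apply: (linearly_isomorphicI (bounded_linear_comp hX hY bf bg)
  (bounded_linear_comp hZ hY bg' bf')) => x; first by rewrite gK fK.
by rewrite f'K g'K.
Qed.

Section Product.
Context X Y (NX : X -> R) (NY : Y -> R).

(** The maximum of two p-norms is a p-norm, equivalent to their l_p combination
but free of powers. *)
Definition prod_norm (z : X * Y) : R := Num.max (NX z.1) (NY z.2).

Lemma prod_norm_le x y a : NX x <= a -> NY y <= a -> prod_norm (x, y) <= a.
Proof. by move=> hx hy; rewrite /prod_norm ge_max hx. Qed.

Lemma le_prod_norm1 z : NX z.1 <= prod_norm z.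
Proof. by rewrite /prod_norm le_max lexx. Qed.

Lemma le_prod_norm2 z : NY z.2 <= prod_norm z.
Proof. by rewrite /prod_norm le_max lexx orbT. Qed.

Lemma prod_norm_quasinorm : is_quasinorm NX -> is_quasinorm NY ->
  is_quasinorm prod_norm.
Proof.
move=> hX hY; split.
- by move=> z; apply: le_trans (quasinorm_ge0 hX z.1) (le_prod_norm1 z).
- move=> [x y]; split=> [e|[-> ->]]; last first.
    by rewrite /prod_norm /= (quasinorm0 hX) (quasinorm0 hY) maxxx.
  have := le_prod_norm1 (x, y); have := le_prod_norm2 (x, y); rewrite e /= => y0 x0.
  by congr pair; [apply/(quasinorm_eq0 hX)|apply/(quasinorm_eq0 hY)];
    apply/eqP; rewrite eq_le ?x0 ?y0 ?(quasinorm_ge0 hX) ?(quasinorm_ge0 hY).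
- by move=> a [x y]; rewrite /prod_norm /= (quasinormZ hX) (quasinormZ hY) maxr_pMr.
- have [k k0 kP] := quasinorm_leD hX; have [l l0 lP] := quasinorm_leD hY.
  exists (k + l) => z t; have s0 : 0 <= prod_norm z + prod_norm t.
    by apply: addr_ge0; apply: le_trans (quasinorm_ge0 hX _) (le_prod_norm1 _).
  apply: prod_norm_le.
    apply: le_trans (kP _ _ _ _ (le_prod_norm1 z) (le_prod_norm1 t)).1 _.
    by rewrite ler_wpM2r // lerDl.
  apply: le_trans (lP _ _ _ _ (le_prod_norm2 z) (le_prod_norm2 t)).1 _.
  by rewrite ler_wpM2r // lerDr.
Qed.

Lemma prod_norm_pbanach p : 0 < p -> is_pbanach p NX -> is_pbanach p NY ->
  is_pbanach p prod_norm.
Proof.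
move=> p0 [[hX tX] cX] [[hY tY] cY]; split; first split.
- exact: prod_norm_quasinorm.
- have N0 := quasinorm_ge0 (prod_norm_quasinorm hX hY).
  have le1 z : NX z.1 `^ p <= prod_norm z `^ p.
    by rewrite ge0_ler_powR ?le_prod_norm1 ?nnegrE ?N0 ?(quasinorm_ge0 hX) // ltW.
  have le2 z : NY z.2 `^ p <= prod_norm z `^ p.
    by rewrite ge0_ler_powR ?le_prod_norm2 ?nnegrE ?N0 ?(quasinorm_ge0 hY) // ltW.
  move=> z t; rewrite {1}/prod_norm maxEle; case: ifP => _.
    exact: le_trans (tY z.2 t.2) (lerD (le2 z) (le2 t)).
  exact: le_trans (tX z.1 t.1) (lerD (le1 z) (le1 t)).
- move=> u uC.
  have [|a ua] := cX (fun n => (u n).1).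
    move=> e e0; apply: filterS (uC e e0) => -[m n] /=.
    by apply: le_lt_trans; exact: (le_prod_norm1 (u m - u n)).
  have [|b ub] := cY (fun n => (u n).2).
    move=> e e0; apply: filterS (uC e e0) => -[m n] /=.
    by apply: le_lt_trans; exact: (le_prod_norm2 (u m - u n)).
  exists (a, b).
  have uab : NX ((u n).1 - a) + NY ((u n).2 - b) @[n --> \oo] --> (0 : R).
    by rewrite -[0 in X in _ --> X]addr0; exact: cvgD.
  apply: (squeeze_cvgr _ (@cvg_cst _ (0 : R) _ _ _) uab); apply: nearW => n.
  rewrite (quasinorm_ge0 (prod_norm_quasinorm hX hY)) /=.
  by apply: prod_norm_le; rewrite ?lerDl ?lerDr ?(quasinorm_ge0 hX) ?(quasinorm_ge0 hY).
Qed.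

Lemma bounded_linear_fst : bounded_linear prod_norm NX fst.
Proof. by split=> //; exists 1 => z; rewrite mul1r le_prod_norm1. Qed.

Lemma bounded_linear_snd : bounded_linear prod_norm NY snd.
Proof. by split=> //; exists 1 => z; rewrite mul1r le_prod_norm2. Qed.

Lemma bounded_linear_pair Z (NZ : Z -> R) (f : Z -> X) (g : Z -> Y) :
  is_quasinorm NZ -> bounded_linear NZ NX f -> bounded_linear NZ NY g ->
  bounded_linear NZ prod_norm (fun z => (f z, g z)).
Proof.
move=> hZ hf hg.
have [C C0 hC] := bounded_linear_bound hZ hf.
have [D D0 hD] := bounded_linear_bound hZ hg.
split=> [a u v|].
  by rewrite (bounded_linearP hf) (bounded_linearP hg).
exists (C + D) => z; apply: prod_norm_le;
  [apply: le_trans (hC z) _|apply: le_trans (hD z) _];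
  by rewrite ler_wpM2r ?(quasinorm_ge0 hZ) // ?lerDl ?lerDr.
Qed.

Lemma bounded_linear_prod_ext Z (NZ : Z -> R) (T T' : X * Y -> Z) :
  bounded_linear prod_norm NZ T -> bounded_linear prod_norm NZ T' ->
  (forall x, T (x, 0) = T' (x, 0)) -> (forall y, T (0, y) = T' (0, y)) ->
  T =1 T'.
Proof.
move=> bT bT' T1 T2 [x y].
have -> : (x, y) = (x, 0) + (0, y) :> X * Y.
  by congr pair; rewrite ?addr0 ?add0r.
by rewrite (bounded_linear_add bT) (bounded_linear_add bT') T1 T2.
Qed.

Hypotheses (hX : is_quasinorm NX) (hY : is_quasinorm NY).

Lemma bounded_linear_inl : bounded_linear NX prod_norm (fun x => (x, 0)).
Proof.
exact: bounded_linear_pair hX (bounded_linear_id NX) (bounded_linear_zero _ hY).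
Qed.

Lemma bounded_linear_inr : bounded_linear NY prod_norm (fun y => (0, y)).
Proof.
exact: bounded_linear_pair hY (bounded_linear_zero _ hX) (bounded_linear_id NY).
Qed.

End Product.

End BoundedLinear.

(** * The range of a projection *)

(** The range of an idempotent P is the set of its fixed vectors. *)
Section FixedSubspace.
Context {R : realType} (F : lmodType R) (P : {linear F -> F}).

Definition fixed_pred : {pred F} := fun v => P v == v.

Lemma fixed_submod : submod_closed fixed_pred.
Proof.
split=> [|a u v /eqP uP /eqP vP]; first by rewrite unfold_in linear0.
by rewrite unfold_in linearP uP vP.
Qed.

HB.instance Definition _ := GRing.isSubmodClosed.Build R F fixed_pred fixed_submod.

Record fixed_subspace := FixedSubspace {
  fixed_val : F; fixed_valP : fixed_val \in fixed_pred }.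

HB.instance Definition _ := [isSub for fixed_val].
HB.instance Definition _ := [Choice of fixed_subspace by <:].
HB.instance Definition _ := [SubChoice_isSubLmodule of fixed_subspace by <:].

End FixedSubspace.

(** * Spaces of type l_p and free spaces *)
Section LpBasis.
Context {R : realType} (p : R).

Definition bounded_family (I : Type) (X : lmodType R) (NX : X -> R)
  (w : I -> X) : Prop := exists C : R, forall i, NX (w i) <= C.

(** The space l_p(I) up to linear isomorphism, by its universal property: for
p <= 1 a bounded operator from l_p(I) to a p-Banach space is the same thing as
a bounded family indexed by I. *)
Record is_lp_basis (I : Type) (X : lmodType R) (NX : X -> R) (e : I -> X) :
    Prop := IsLpBasis {
  lp_pbanach : is_pbanach p NX;
  lp_bounded : bounded_family NX e;
  lp_extend : forall (Y : lmodType R) (NY : Y -> R), is_pbanach p NY ->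
    forall w : I -> Y, bounded_family NY w ->
    exists2 T, bounded_linear NX NY T & forall i, T (e i) = w i;
  lp_unique : forall (Y : lmodType R) (NY : Y -> R), is_pbanach p NY ->
    forall T T' : X -> Y, bounded_linear NX NY T -> bounded_linear NX NY T' ->
    (forall i, T (e i) = T' (e i)) -> T =1 T' }.

Lemma lp_basis_reindex (I J : Type) (X : lmodType R) (NX : X -> R)
    (e : I -> X) (c : J -> I) :
  bijective c -> is_lp_basis NX e -> is_lp_basis NX (e \o c).
Proof.
move=> [c' cK c'K] [hX [C eC] ext uniq]; split=> //; first by exists C => j; apply: eC.
- move=> Y NY hY w [D wD]; have [|T bT TE] := ext _ _ hY (w \o c').
    by exists D => i; apply: wD.
  by exists T => // j; rewrite /= TE /= cK.
- move=> Y NY hY T T' bT bT' TT'; apply: (uniq _ _ hY) => // i.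
  by rewrite -(c'K i); apply: TT'.
Qed.

Section Free.
Context (M : Type) (d : M -> M -> R) (o : M) (F : lmodType R) (NF : F -> R)
  (delta : M -> F).
Hypothesis free : is_lipschitz_free p d o NF delta.

Let hF : is_pbanach p NF := free_pbanach free.
Let qF : is_quasinorm NF := pnorm_quasinorm hF.1.

(** The map f need not vanish at the base point: subtracting f o repairs this. *)
Lemma free_extend (X : lmodType R) (NX : X -> R) (f : M -> X) :
  is_pbanach p NX -> lipschitz_map d NX f ->
  exists2 T, bounded_linear NF NX T & forall x, T (delta x) = f x - f o.
Proof.
move=> hX [L fL].
have [|/=|T [bT TE _ _]] := free_universal free hX (f := fun x => f x - f o).
- by exists L => x y; rewrite opprB addrA subrK.
- by rewrite subrr.
- by exists T => //; apply: bounded_linear_linear.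
Qed.

Lemma free_unique (X : lmodType R) (NX : X -> R) (T T' : F -> X) :
  is_pbanach p NX -> bounded_linear NF NX T -> bounded_linear NF NX T' ->
  (forall x, T (delta x) = T' (delta x)) -> T =1 T'.
Proof.
move=> hX bT bT' TT' v.
have [|/=|S [_ _ _ SU]] := free_universal free hX (f := T \o delta).
- have [C C0 hC] := bounded_linear_bound qF bT.
  exists C => x y /=; rewrite -(bounded_linear_sub bT) -(free_isometry free).
  exact: hC.
- by rewrite /= (free_base free) (bounded_linear0 bT).
have [U bU UT] := bounded_linear_bundle bT.
have [U' bU' UT'] := bounded_linear_bundle bT'.
have USv : U v = S v by apply: SU => // x; rewrite UT.
have USv' : U' v = S v by apply: SU => // x; rewrite UT' -TT'.
by rewrite -UT -UT' USv USv'.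
Qed.

End Free.

(** If u n = P (u n) tends to l in F then it also tends to P l, so that fixed
vectors have a fixed limit. *)
Lemma fixed_pbanach (F : lmodType R) (NF : F -> R) (P : {linear F -> F}) :
  is_pbanach p NF -> bounded_linear NF NF P -> (forall v, P (P v) = P v) ->
  is_pbanach p (fun v : fixed_subspace P => NF (\val v)).
Proof.
move=> [[qF tF] cF] bP PP; split; first split.
- split=> [x|x|a x|].
  + exact: quasinorm_ge0.
  + split=> [/(quasinorm_eq0 qF) e|->]; first exact: val_inj.
    by rewrite linear0; apply/(quasinorm_eq0 qF).
  + by rewrite linearZ (quasinormZ qF).
  + by have [k kP] := quasinormD qF; exists k => x y; rewrite linearD.
- by move=> x y; rewrite linearD.
- move=> u uC; have [e e0|l ul] := cF (fun n => \val (u n)).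
    by apply: filterS (uC e e0) => -[m n]; rewrite linearB.
  have Pl : P l \in fixed_pred P by rewrite unfold_in PP.
  exists (FixedSubspace Pl); have [C C0 hC] := bounded_linear_bound qF bP.
  have Cul : C * NF (\val (u n) - l) @[n --> \oo] --> (0 : R).
    by rewrite -[0 in X in _ --> X](mulr0 C); apply: cvgMr.
  apply: (squeeze_cvgr _ (@cvg_cst _ (0 : R) _ _ _) Cul); apply: nearW => n.
  apply/andP; split; first exact: (quasinorm_ge0 qF).
  have -> : \val (u n - FixedSubspace Pl) = P (\val (u n) - l).
    have uP : P (\val (u n)) = \val (u n) := eqP (fixed_valP (u n)).
    by rewrite !linearB uP.
  exact: hC.
Qed.

(** Take for ry.1 the infimum of the distances from x to the other points.  It
need not be attained, whence the factor 2. *)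
Lemma almost_nearest_point (M : Type) (d : M -> M -> R) (eps : R) (x z : M) :
  0 < eps ->
  (forall x y, x <> y -> eps <= d x y) -> x <> z ->
  exists ry : R * M, [/\ 0 < ry.1, ry.2 <> x, d x ry.2 <= 2 * ry.1 &
    forall z, x <> z -> ry.1 <= d x z].
Proof.
move=> e0 sep xz; pose S := [set d x y | y in [set y | x <> y]].
have Sinf : has_inf S.
  split; first by exists (d x z); exists z.
  by exists eps => _ [y /= xy <-]; apply: sep.
have infS : eps <= inf S.
  by apply: lb_le_inf; [exact: Sinf.1|move=> _ [y /= xy <-]; apply: sep].
have i0 : 0 < inf S by apply: lt_le_trans infS.
have [_ [y xy <-] yS] := inf_adherent i0 Sinf.
exists (inf S, y); split=> //=; first exact: nesym.
- by rewrite mulr_natl mulr2n ltW.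
- by move=> t xt; apply: ge_inf; [exact: Sinf.2|exists t].
Qed.

(** A p-metric is a quasi-metric with constant 2 `^ p^-1. *)
Lemma pmetric_quasi (M : Type) (d : M -> M -> R) : 0 < p -> is_pmetric p d ->
  exists2 K, 0 <= K & forall x y z, d x y <= K * (d x z + d z y).
Proof.
move=> p0 hd; exists (2 `^ p^-1) => [|x y z]; first exact: powR_ge0.
have d0 := pmetric_ge0 hd; rewrite leNgt; apply/negP => lt.
have m0 : 0 <= d x z + d z y by rewrite addr_ge0.
have : (2 `^ p^-1 * (d x z + d z y)) `^ p < d x y `^ p.
  by apply: gt0_ltr_powR => //; rewrite nnegrE ?d0 // mulr_ge0 ?powR_ge0.
rewrite powRM ?powR_ge0 // -powRrM mulVf ?gt_eqF // powRr1 //.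
apply/negP; rewrite -leNgt; apply: le_trans (pmetric_triangle hd x y z) _.
rewrite mulr_natl mulr2n; apply: lerD; apply: ge0_ler_powR;
  by rewrite ?nnegrE ?(ltW p0) ?lerDl ?lerDr ?d0 ?m0.
Qed.

(** A map whose value at x is bounded by a multiple of r x is Lipschitz,
because r x and r z are both at most d x z. *)
Lemma sparse_lipschitz (M : Type) (d : M -> M -> R) (r : M -> R)
    (k : M -> option M) (X : lmodType R) (NX : X -> R) (w : M -> X) :
  is_pmetric p d -> (forall x, 0 < r x) -> (forall x z, x <> z -> r x <= d x z) ->
  is_quasinorm NX -> bounded_family NX w ->
  lipschitz_map d NX (fun x => if k x is Some s then r x *: w s else 0).
Proof.
move=> hd r0 rd qX [C wC]; have [K K0 hK] := quasinorm_leD qX.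
pose f x := if k x is Some s then r x *: w s else 0.
have fC x : NX (f x) <= `|C| * r x.
  rewrite /f; case: (k x) => [s|].
    rewrite (quasinormZ qX) gtr0_norm // mulrC ler_pM2r //.
    exact: le_trans (wC s) (ler_norm _).
  by rewrite (quasinorm0 qX) mulr_ge0 // ltW.
exists (2 * K * `|C|) => x z; rewrite -/(f x) -/(f z).
have [<-|xz] := pselect (x = z).
  by rewrite subrr (quasinorm0 qX) !mulr_ge0 // (pmetric_ge0 hd).
apply: le_trans (hK _ _ _ _ (fC x) (fC z)).2 _.
rewrite -mulrDr -!mulrA [2 * _]mulrC -!mulrA; do 2 apply: ler_wpM2l => //.
rewrite mulr_natr mulr2n lerD // ?rd //.
by rewrite (pmetric_sym hd) rd //; exact: nesym.
Qed.

(** The free space on an infinite separated set M contains a complemented copy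
of l_p(M), with basis eps_ s = (delta (b s) - delta (y (b s))) / r (b s) where b
is an injection of M in M whose range avoids its image under y.  A bounded
family w is extended by the map with value r x * w s at x = b s and 0
elsewhere: it takes the value 0 at y (b s), hence eps_ s goes to w s.  Applied
to w = eps_ this gives the projection. *)
Lemma free_lp_complement (M : Type) (d : M -> M -> R) (o : M) (F : lmodType R)
    (NF : F -> R) (delta : M -> F) (eps : R) :
  is_pmetric p d -> 0 < eps -> (forall x y, x <> y -> eps <= d x y) ->
  infinite_set [set: M] -> is_lipschitz_free p d o NF delta ->
  exists (L : lmodType R) (NL : L -> R) (e : M -> L) (J : L -> F) (Q : F -> L),
    [/\ is_lp_basis NL e, bounded_linear NL NF J, bounded_linear NF NL Q &
        cancel J Q].
Proof.
move=> hd e0 sep infM free.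
have hF := free_pbanach free; have qF := pnorm_quasinorm hF.1.
have ntM (x : M) : exists z, x <> z.
  apply: contrapT => /forallNP xM; apply: infM.
  apply: sub_finite_set (finite_set1 x) => z _.
  by apply: contrapT => zx; exact: xM (nesym zx).
have /choice[ry ryP] (x : M) : exists ry : R * M, [/\ 0 < ry.1, ry.2 <> x,
    d x ry.2 <= 2 * ry.1 & forall z, x <> z -> ry.1 <= d x z].
  by have [z xz] := ntM x; exact: almost_nearest_point e0 sep xz.
pose r x := (ry x).1; pose y x := (ry x).2.
have r0 x : 0 < r x by have [] := ryP x.
have rd x z : x <> z -> r x <= d x z by have [_ _ _] := ryP x; apply.
have dy x : d x (y x) <= 2 * r x by have [] := ryP x.
have [b binj yb] : exists2 b : M -> M, injective b & forall s t, y (b s) <> b t.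
  by apply: injective_independent => // x; have [] := ryP x.
(* k is the partial inverse of b. *)
have /choice[k kP] (x : M) : exists k : option M,
    match k with Some s => x = b s | None => forall s, x <> b s end.
  have [[s xs]|/forallNP nx] := pselect (exists s, x = b s); first by exists (Some s).
  by exists None.
have kb s : k (b s) = Some s.
  by have := kP (b s); case: (k _) => [t /binj ->//|/(_ s)].
have ky s : k (y (b s)) = None.
  by have := kP (y (b s)); case: (k _) => [t /yb|].
pose f (X : lmodType R) (w : M -> X) x := if k x is Some s then r x *: w s else 0.
pose eps_ s := (r (b s))^-1 *: (delta (b s) - delta (y (b s))).
have ext (X : lmodType R) (NX : X -> R) (w : M -> X) : is_pbanach p NX ->
    bounded_family NX w -> exists T, [/\ bounded_linear NF NX T,
      forall x, T (delta x) = f X w x - f X w o & forall s, T (eps_ s) = w s].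
  move=> hX bw; have [|T bT TE] := free_extend free hX (f := f X w).
    exact: sparse_lipschitz (pnorm_quasinorm hX.1) bw.
  exists T; split=> // s; rewrite (bounded_linear_scale _ bT).
  rewrite (bounded_linear_sub bT) !TE opprB addrA subrK /f kb ky subr0.
  by rewrite scalerA mulVf ?scale1r // gt_eqF.
have beps : bounded_family NF eps_.
  exists 2 => s; rewrite (quasinormZ qF) (free_isometry free) normfV gtr0_norm //.
  by rewrite ler_pdivrMl // mulrC.
have [P0 [bP0 P0d P0e]] := ext _ _ _ hF beps.
have [P bP PP0] := bounded_linear_bundle bP0.
have {}bP := bounded_linear_linear bP.
have Pd x : P (delta x) = f F eps_ x - f F eps_ o by rewrite PP0.
have Pe s : P (eps_ s) = eps_ s by rewrite PP0.
have linf (X Y : lmodType R) (NX : X -> R) (NY : Y -> R) (S : X -> Y) w x :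
    bounded_linear NX NY S -> S (f X w x) = f Y (S \o w) x.
  move=> bS; rewrite /f; case: (k x) => [s|]; first exact: bounded_linear_scale bS _.
  exact: bounded_linear0 bS.
have PPe : P \o eps_ = eps_ by apply/funext => s; rewrite /= Pe.
have PP v : P (P v) = P v.
  apply: (free_unique free hF (bounded_linear_comp qF qF bP bP) bP) => x.
  by rewrite Pd (bounded_linear_sub bP) !(linf _ _ _ _ _ _ _ bP) PPe.
have fixP v : P v \in fixed_pred P by rewrite unfold_in PP.
have fixe s : eps_ s \in fixed_pred P by rewrite unfold_in Pe.
pose NL (v : fixed_subspace P) := NF (\val v).
pose e s : fixed_subspace P := FixedSubspace (fixe s).
pose Q v : fixed_subspace P := FixedSubspace (fixP v).
have hL : is_pbanach p NL := fixed_pbanach hF bP PP.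
have qL := pnorm_quasinorm hL.1.
have QK : cancel (fun v => \val v) Q.
  by move=> v; apply: val_inj; apply: (eqP (fixed_valP v)).
have bJ : bounded_linear NL NF (fun v => \val v).
  split=> [a u v|]; first by rewrite linearP.
  by exists 1 => v; rewrite mul1r.
have bQ : bounded_linear NF NL Q.
  split=> [a u v|]; first by apply: val_inj; rewrite linearP /= linearP.
  by have [_ [C hC]] := bP; exists C => v; exact: hC.
exists (fixed_subspace P), NL, e, (fun v => \val v), Q; split=> //; split=> //.
- move=> Y NY hY w bw; have [T [bT _ Te]] := ext _ _ _ hY bw.
  by exists (fun v => T (\val v)) => [|s]; [exact: bounded_linear_comp bJ bT|exact: Te].
- move=> Y NY hY T T' bT bT' TT' v; rewrite -(QK v).
  have Qd x : Q (delta x) = f _ e x - f _ e o.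
    by apply: val_inj; rewrite (bounded_linear_sub bJ) !(linf _ _ _ _ _ _ _ bJ) /= Pd.
  apply: (free_unique free hY (bounded_linear_comp qF qL bQ bT)
    (bounded_linear_comp qF qL bQ bT')) => x.
  rewrite Qd (bounded_linear_sub bT) (bounded_linear_sub bT').
  rewrite !(linf _ _ _ _ _ _ _ bT) !(linf _ _ _ _ _ _ _ bT').
  by rewrite (_ : T \o e = T' \o e) //; apply/funext => s; exact: TT'.
Qed.

(** * Absorption of an l_p summand *)
Lemma lp_basis_isomorphic (I : Type) (X Y : lmodType R) (NX : X -> R)
    (NY : Y -> R) (e : I -> X) (f : I -> Y) :
  is_lp_basis NX e -> is_lp_basis NY f -> linearly_isomorphic NX NY.
Proof.
move=> [hX bX extX uX] [hY bY extY uY].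
have [T bT Te] := extX _ _ hY _ bY; have [S bS Sf] := extY _ _ hX _ bX.
have qX := pnorm_quasinorm hX.1; have qY := pnorm_quasinorm hY.1.
apply: (linearly_isomorphicI bT bS).
- apply: (uX _ _ hX _ _ (bounded_linear_comp qX qY bT bS) (bounded_linear_id NX)).
  by move=> i; rewrite Te Sf.
- apply: (uY _ _ hY _ _ (bounded_linear_comp qY qX bS bT) (bounded_linear_id NY)).
  by move=> i; rewrite Sf Te.
Qed.

Hypothesis p0 : 0 < p.

Lemma lp_basis_prod (I J : Type) (X Y : lmodType R) (NX : X -> R)
    (NY : Y -> R) (e : I -> X) (f : J -> Y) :
  is_lp_basis NX e -> is_lp_basis NY f ->
  is_lp_basis (prod_norm NX NY)
    (fun z : I + J => match z with inl i => (e i, 0) | inr j => (0, f j) end).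
Proof.
move=> [hX [C hC] extX uX] [hY [D hD] extY uY].
have qX := pnorm_quasinorm hX.1; have qY := pnorm_quasinorm hY.1.
have bfst := bounded_linear_fst NX NY; have bsnd := bounded_linear_snd NX NY.
have qXY := prod_norm_quasinorm qX qY.
split; first exact: prod_norm_pbanach.
- exists (`|C| + `|D|) => -[i|j]; apply: prod_norm_le;
    rewrite /= ?(quasinorm0 qX) ?(quasinorm0 qY) ?addr_ge0 //.
    by apply: le_trans (hC i) _; apply: le_trans (ler_norm _) _; rewrite lerDl.
  by apply: le_trans (hD j) _; apply: le_trans (ler_norm _) _; rewrite lerDr.
- move=> Z NZ hZ w [E hE]; have qZ := pnorm_quasinorm hZ.1.
  have [|T bT Te] := extX _ _ hZ (w \o inl); first by exists E => i; exact: hE.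
  have [|S bS Sf] := extY _ _ hZ (w \o inr); first by exists E => i; exact: hE.
  exists (fun z => T z.1 + S z.2).
    by apply: bounded_linear_add_fun; rewrite //;
       [exact: bounded_linear_comp bfst bT|exact: bounded_linear_comp bsnd bS].
  case=> [i|j] /=; first by rewrite Te (bounded_linear0 bS) addr0.
  by rewrite Sf (bounded_linear0 bT) add0r.
- move=> Z NZ hZ T T' bT bT' TT'.
  have binl := bounded_linear_inl qX qY; have binr := bounded_linear_inr qX qY.
  apply: (bounded_linear_prod_ext bT bT').
    apply: (uX _ _ hZ _ _ (bounded_linear_comp qX qXY binl bT)
      (bounded_linear_comp qX qXY binl bT')) => i; exact: (TT' (inl i)).
  apply: (uY _ _ hZ _ _ (bounded_linear_comp qY qXY binr bT)
      (bounded_linear_comp qY qXY binr bT')) => j; exact: (TT' (inr j)).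
Qed.

(** Write F = ker Q + J(L).  Since L is isomorphic to L x L through phi, with
inverse psi, the summand J(L) can release one copy of L. *)
Lemma free_absorb (M : Type) (d : M -> M -> R) (o : M) (F : lmodType R)
    (NF : F -> R) (delta : M -> F) (eps : R) :
  is_pmetric p d -> 0 < eps -> (forall x y, x <> y -> eps <= d x y) ->
  infinite_set [set: M] -> is_lipschitz_free p d o NF delta ->
  exists (L : lmodType R) (NL : L -> R) (e : M -> L),
    is_lp_basis NL e /\ linearly_isomorphic NF (prod_norm NF NL).
Proof.
move=> hd e0 sep infM free.
have [L [NL [e [J [Q [hL bJ bQ JK]]]]]] := free_lp_complement hd e0 sep infM free.
have qF := pnorm_quasinorm (free_pbanach free).1.
have qL := pnorm_quasinorm (lp_pbanach hL).1.
have qLL := prod_norm_quasinorm qL qL.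
have qFL := prod_norm_quasinorm qF qL.
exists L, NL, e; split=> //.
have [c cbij] := bijective_sum_infinite infM.
have [phi [psi [bphi bpsi phiK psiK]]] := linearly_isomorphicE
  (lp_basis_isomorphic (lp_basis_reindex cbij hL) (lp_basis_prod hL hL)).
have bJQ := bounded_linear_comp qF qL bQ bJ.
have bphiQ := bounded_linear_comp qF qL bQ bphi.
have bfst := bounded_linear_fst NF NL; have bsnd := bounded_linear_snd NF NL.
pose f v := (v - J (Q v) + J (phi (Q v)).1, (phi (Q v)).2).
pose g z := z.1 - J (Q z.1) + J (psi (Q z.1, z.2)).
have QE v l : Q (v - J (Q v) + J l) = l.
  by rewrite (bounded_linear_add bQ) (bounded_linear_sub bQ) !JK subrr add0r.
apply: (@linearly_isomorphicI _ _ _ _ _ f g).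
- apply: (bounded_linear_pair qF).
    apply: (bounded_linear_add_fun qF qF).
      exact: (bounded_linear_sub_fun qF qF (bounded_linear_id NF) bJQ).
    apply: (bounded_linear_comp qF qL _ bJ).
    exact: bounded_linear_comp qF qLL bphiQ (bounded_linear_fst NL NL).
  exact: bounded_linear_comp qF qLL bphiQ (bounded_linear_snd NL NL).
- apply: (bounded_linear_add_fun qFL qF).
    apply: (bounded_linear_sub_fun qFL qF) => //.
    exact: (bounded_linear_comp qFL qF bfst bJQ).
  apply: (bounded_linear_comp qFL qL _ bJ).
  apply: (bounded_linear_comp qFL qLL _ bpsi).
  apply: bounded_linear_pair => //.
  exact: (bounded_linear_comp qFL qF bfst bQ).
- move=> v; rewrite /g /f /= !QE.
  rewrite -surjective_pairing phiK addrK subrK //.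
- case=> w s; rewrite /f /g /= !QE !psiK /=.
  by rewrite addrK subrK.
Qed.

(** * Exchanging two nets *)

(** The isomorphism between the two models F1 x L1 and F2 x L2 of the free
space of the disjoint union of M1 and M2, on generators.  The family e1, indexed
by M2, stands for the differences between the points y of M2 and their
companions g y in M1; symmetrically e2 for the points of M1. *)
Definition cross_spec (M1 M2 : Type) (o1 : M1) (F1 F2 L1 L2 : lmodType R)
    (NF1 : F1 -> R) (NF2 : F2 -> R) (NL1 : L1 -> R) (NL2 : L2 -> R)
    (delta1 : M1 -> F1) (delta2 : M2 -> F2) (e1 : M2 -> L1) (e2 : M1 -> L2)
    (h : M1 -> M2) (g : M2 -> M1) (T : F1 * L1 -> F2 * L2) : Prop :=
  [/\ bounded_linear (prod_norm NF1 NL1) (prod_norm NF2 NL2) T,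
    forall x, T (delta1 x, 0) = (delta2 (h x), e2 x) - (delta2 (h o1), e2 o1) &
    forall y, T (0, e1 y) = (delta2 y, 0) - (delta2 (h (g y)), e2 (g y))].

(** The map x |-> (delta2 (h x), e2 x) is Lipschitz because a bounded family is
Lipschitz on a separated set, and the images of the e1 y are bounded because y
and h (g y) are at bounded distance. *)
Lemma cross_exists (M1 M2 : Type) (d1 : M1 -> M1 -> R) (d2 : M2 -> M2 -> R)
    (o1 : M1) (o2 : M2) (F1 F2 L1 L2 : lmodType R) (NF1 : F1 -> R)
    (NF2 : F2 -> R) (NL1 : L1 -> R) (NL2 : L2 -> R) (delta1 : M1 -> F1)
    (delta2 : M2 -> F2) (e1 : M2 -> L1) (e2 : M1 -> L2) (h : M1 -> M2)
    (g : M2 -> M1) (eps A B : R) :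
  is_pmetric p d1 -> 0 < eps -> (forall x y, x <> y -> eps <= d1 x y) ->
  is_lipschitz_free p d1 o1 NF1 delta1 -> is_lipschitz_free p d2 o2 NF2 delta2 ->
  is_lp_basis NL1 e1 -> is_lp_basis NL2 e2 ->
  (forall x z, d2 (h x) (h z) <= A * d1 x z) -> (forall y, d2 y (h (g y)) <= B) ->
  exists T, cross_spec o1 NF1 NF2 NL1 NL2 delta1 delta2 e1 e2 h g T.
Proof.
move=> hd e0 sep free1 free2 hL1 hL2 hA hB.
have hF1 := free_pbanach free1; have hF2 := free_pbanach free2.
have qF1 := pnorm_quasinorm hF1.1; have qF2 := pnorm_quasinorm hF2.1.
have qL1 := pnorm_quasinorm (lp_pbanach hL1).1.
have qL2 := pnorm_quasinorm (lp_pbanach hL2).1.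
have hFL := prod_norm_pbanach p0 hF2 (lp_pbanach hL2).
have qFL := pnorm_quasinorm hFL.1.
have [C hC] := lp_bounded hL2; have [K K0 hK] := quasinorm_leD qL2.
pose u x := (delta2 (h x), e2 x).
have d0 x z := pmetric_ge0 hd x z.
have KC0 : 0 <= K * (`|C| + `|C|) by rewrite mulr_ge0 // addr_ge0.
have KCe0 : 0 <= K * (`|C| + `|C|) / eps by rewrite divr_ge0 // ltW.
have [|T bT Td] := free_extend free1 hFL (f := u).
  exists (`|A| + K * (`|C| + `|C|) / eps) => x z.
  have [<-|xz] := pselect (x = z).
    by rewrite subrr (quasinorm0 qFL) mulr_ge0 // addr_ge0.
  apply: prod_norm_le; rewrite mulrDl.
    rewrite /= (free_isometry free2); apply: le_trans (hA x z) _.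
    rewrite -[leLHS]addr0; apply: lerD; first by rewrite ler_wpM2r // ler_norm.
    by rewrite mulr_ge0.
  rewrite /=; have CC x' : NL2 (e2 x') <= `|C| by apply: le_trans (hC _) (ler_norm _).
  apply: le_trans (hK _ _ _ _ (CC x) (CC z)).2 _.
  rewrite -[leLHS]add0r; apply: lerD; first by rewrite mulr_ge0.
  rewrite -mulrA ler_peMr //.
  by rewrite mulrC ler_pdivlMr // mul1r sep.
have [|S bS Se] := lp_extend hL1 hFL (w := fun y => (delta2 y, 0) - u (g y)).
  exists (`|B| + `|C|) => y; apply: prod_norm_le => /=.
    rewrite (free_isometry free2); apply: le_trans (hB y) _.
    by apply: le_trans (ler_norm _) _; rewrite lerDl.
  rewrite sub0r (quasinormN _ qL2); apply: le_trans (hC _) _.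
  by apply: le_trans (ler_norm _) _; rewrite lerDr.
exists (fun z => T z.1 + S z.2); split.
- have qFL1 := prod_norm_quasinorm qF1 qL1.
  apply: (bounded_linear_add_fun qFL1 qFL).
    exact: bounded_linear_comp qFL1 qF1 (bounded_linear_fst NF1 NL1) bT.
  exact: bounded_linear_comp qFL1 qL1 (bounded_linear_snd NF1 NL1) bS.
- by move=> x /=; rewrite Td (bounded_linear0 bS) addr0.
- by move=> y /=; rewrite Se (bounded_linear0 bT) add0r.
Qed.

Lemma free_prod_unique (M I : Type) (d : M -> M -> R) (o : M)
    (F L X : lmodType R) (NF : F -> R) (NL : L -> R) (NX : X -> R)
    (delta : M -> F) (e : I -> L) (T T' : F * L -> X) :
  is_lipschitz_free p d o NF delta -> is_lp_basis NL e -> is_pbanach p NX ->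
  bounded_linear (prod_norm NF NL) NX T ->
  bounded_linear (prod_norm NF NL) NX T' ->
  (forall x, T (delta x, 0) = T' (delta x, 0)) ->
  (forall i, T (0, e i) = T' (0, e i)) -> T =1 T'.
Proof.
move=> free hL hX bT bT' TT1 TT2.
have qF := pnorm_quasinorm (free_pbanach free).1.
have qL := pnorm_quasinorm (lp_pbanach hL).1.
have qFL := prod_norm_quasinorm qF qL.
have binl := bounded_linear_inl qF qL; have binr := bounded_linear_inr qF qL.
apply: (bounded_linear_prod_ext bT bT').
  exact: (free_unique free hX (bounded_linear_comp qF qFL binl bT)
    (bounded_linear_comp qF qFL binl bT')).
exact: (lp_unique hL hX (bounded_linear_comp qL qFL binr bT)
  (bounded_linear_comp qL qFL binr bT')).
Qed.

(** By uniqueness it suffices to compute on generators, where S maps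
(delta2 (h x), e2 x) to (delta1 x, 0) up to a constant: the two occurrences of
the companion of h x cancel. *)
Lemma cross_cancel (M1 M2 : Type) (d1 : M1 -> M1 -> R)
    (o1 : M1) (o2 : M2) (F1 F2 L1 L2 : lmodType R) (NF1 : F1 -> R)
    (NF2 : F2 -> R) (NL1 : L1 -> R) (NL2 : L2 -> R) (delta1 : M1 -> F1)
    (delta2 : M2 -> F2) (e1 : M2 -> L1) (e2 : M1 -> L2) (h : M1 -> M2)
    (g : M2 -> M1) T S :
  is_lipschitz_free p d1 o1 NF1 delta1 -> is_lp_basis NL1 e1 ->
  is_quasinorm NF2 -> is_quasinorm NL2 ->
  cross_spec o1 NF1 NF2 NL1 NL2 delta1 delta2 e1 e2 h g T ->
  cross_spec o2 NF2 NF1 NL2 NL1 delta2 delta1 e2 e1 g h S ->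
  cancel T S.
Proof.
move=> free hL qF2 qL2 [bT T1 T2] [bS S1 S2].
have hF := free_pbanach free; have qF := pnorm_quasinorm hF.1.
have qL := pnorm_quasinorm (lp_pbanach hL).1.
have qFL := prod_norm_quasinorm qF qL.
have Su x : S (delta2 (h x), e2 x) = (delta1 x, 0) - (delta1 (g o2), e1 o2).
  have -> : (delta2 (h x), e2 x) = (delta2 (h x), 0) + (0, e2 x) :> F2 * L2.
    by congr pair; rewrite ?addr0 ?add0r.
  by rewrite (bounded_linear_add bS) S1 S2 addrC addrA subrK.
have hFL := prod_norm_pbanach p0 hF (lp_pbanach hL).
apply: (free_prod_unique free hL hFL (bounded_linear_comp qFL
  (prod_norm_quasinorm qF2 qL2) bT bS) (bounded_linear_id _)).
- move=> x; rewrite T1 (bounded_linear_sub bS) !Su opprB addrA subrK.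
  by congr pair; rewrite /= ?(free_base free) subr0.
- move=> y; rewrite T2 (bounded_linear_sub bS) Su S1 opprB addrA subrK.
  by congr pair; rewrite /= ?subrr ?subr0.
Qed.

Lemma bilipschitz_free_isomorphic (M1 M2 : Type) (d1 : M1 -> M1 -> R)
    (d2 : M2 -> M2 -> R) (o1 : M1) (o2 : M2) (F1 F2 : lmodType R)
    (NF1 : F1 -> R) (NF2 : F2 -> R) (delta1 : M1 -> F1) (delta2 : M2 -> F2)
    (c : M1 -> M2) (c' : M2 -> M1) (A B : R) :
  is_lipschitz_free p d1 o1 NF1 delta1 -> is_lipschitz_free p d2 o2 NF2 delta2 ->
  cancel c c' -> cancel c' c -> (forall x z, d2 (c x) (c z) <= A * d1 x z) ->
  (forall x z, d1 (c' x) (c' z) <= B * d2 x z) -> linearly_isomorphic NF1 NF2.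
Proof.
move=> free1 free2 cK c'K hA hB.
have hF1 := free_pbanach free1; have hF2 := free_pbanach free2.
have qF1 := pnorm_quasinorm hF1.1; have qF2 := pnorm_quasinorm hF2.1.
have [|T bT TE] := free_extend free1 hF2 (f := delta2 \o c).
  by exists A => x z; rewrite (free_isometry free2).
have [|S bS SE] := free_extend free2 hF1 (f := delta1 \o c').
  by exists B => x z; rewrite (free_isometry free1).
apply: (linearly_isomorphicI bT bS).
- apply: (free_unique free1 hF1 (bounded_linear_comp qF1 qF2 bT bS)
    (bounded_linear_id _)) => x.
  rewrite TE (bounded_linear_sub bS) !SE /= !cK opprB addrA subrK.
  by rewrite (free_base free1) subr0.
- apply: (free_unique free2 hF2 (bounded_linear_comp qF2 qF1 bS bT)
    (bounded_linear_id _)) => x.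
  rewrite SE (bounded_linear_sub bT) !TE /= !c'K opprB addrA subrK.
  by rewrite (free_base free2) subr0.
Qed.

(** The distances between images are bounded by finiteness, and the distances
between distinct points are bounded below by separation. *)
Lemma finite_lipschitz (M1 M2 : Type) (d1 : M1 -> M1 -> R)
    (d2 : M2 -> M2 -> R) (c : M1 -> M2) (eps : R) :
  is_pmetric p d1 -> is_pmetric p d2 -> 0 < eps ->
  (forall x y, x <> y -> eps <= d1 x y) -> finite_set [set: M1] ->
  exists A, forall x z, d2 (c x) (c z) <= A * d1 x z.
Proof.
move=> hd1 hd2 e0 sep finM.
have finS : finite_set [set d2 (c z.1) (c z.2) | z in [set: M1] `*` [set: M1]].
  by apply: finite_image; exact: finite_setX.
have /finite_seqP[s sE] := finS.
pose B := \big[Num.max/0]_(x <- s) x.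
have dB x z : d2 (c x) (c z) <= B.
  apply: (@le_bigmax_seq _ _ _ s 0 _ xpredT id) => //.
  have : [set` s] (d2 (c x) (c z)) by rewrite -sE; exists (x, z).
  by [].
exists (B / eps) => x z; have [<-|xz] := pselect (x = z).
  by rewrite (pmetric_eq0 hd2 (c x) (c x)).2 // (pmetric_eq0 hd1 x x).2 // mulr0.
apply: le_trans (dB x z) _; rewrite mulrAC ler_pdivlMr //.
by rewrite ler_wpM2l ?sep // (le_trans (pmetric_ge0 hd2 (c x) (c z)) (dB x z)).
Qed.

(** * Nets *)
Lemma net_separated (M : Type) (d : M -> M -> R) (N : set M) : is_net d N ->
  exists2 eps, 0 < eps & forall x y : N, x <> y -> eps <= subdist d x y.
Proof.
move=> [sep _].
have le x y : N x -> N y -> x <> y -> (separation d N <= (d x y)%:E)%E.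
  by move=> Nx Ny xy; apply: ereal_inf_lbound; exists (x, y).
have [eps e0 hsep] : exists2 eps : R, 0 < eps & (eps%:E <= separation d N)%E.
  move: sep; case: (separation d N) => [r|_|//]; first by exists r.
  by exists 1 => //; exact: leey.
exists eps => // x y xy; rewrite -lee_fin; apply: le_trans hsep (le _ _ _ _ _);
  [exact: set_valP|exact: set_valP|by move=> /val_inj].
Qed.

Lemma net_retraction (M : Type) (d : M -> M -> R) (N : set M) : is_net d N ->
  exists (B : R) (g : M -> N), forall x, d x (\val (g x)) <= B.
Proof.
move=> [_ cov].
have [B hB] : exists B : R, (ereal_sup (range (dist_to_set d ^~ N)) < B%:E)%E.
  move: cov; case: (ereal_sup _) => [r _||_] //; last by exists 0; rewrite ltNyr.
  by exists (r + 1); rewrite lte_fin ltrDl.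
have /choice[g gP] (x : M) : exists y : N, d x (\val y) <= B.
  have : (dist_to_set d x N < B%:E)%E.
    by apply: le_lt_trans hB; apply: ereal_sup_ubound; exists x.
  move=> /ereal_inf_lt[_ [y Ny <-]]; rewrite lte_fin => /ltW yB.
  by exists (SigSub (mem_set Ny)).
by exists B, g.
Qed.

(** A map at bounded distance from the identity is Lipschitz on a separated
set: the bounded error is at most a multiple of the distance between two
distinct points. *)
Lemma net_retraction_lipschitz (M : Type) (d : M -> M -> R) (N N' : set M)
    (h : M -> N') (eps B : R) :
  is_pmetric p d -> 0 < eps ->
  (forall x y : N, x <> y -> eps <= subdist d x y) ->
  (forall x, d x (\val (h x)) <= B) ->
  exists A, forall x z : N,
    subdist d (h (\val x)) (h (\val z)) <= A * subdist d x z.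
Proof.
move=> hd e0 sep hB; have [K K0 dK] := pmetric_quasi p0 hd.
have d0 := pmetric_ge0 hd.
exists (K * (B / eps + K * (1 + B / eps))) => x z.
have [<-|xz] := pselect (x = z).
  by rewrite /subdist !(pmetric_eq0 hd _ _).2 // mulr0.
have B0 : 0 <= B := le_trans (d0 _ _) (hB (\val x)).
have Be : B <= B / eps * d (\val x) (\val z).
  by rewrite mulrAC ler_pdivlMr // ler_wpM2l // sep.
rewrite /subdist; apply: le_trans (dK _ _ (\val x)) _.
rewrite -mulrA ler_wpM2l // mulrDl; apply: lerD.
  by rewrite (pmetric_sym hd); apply: le_trans (hB _) Be.
apply: le_trans (dK _ _ (\val z)) _.
rewrite -mulrA ler_wpM2l // mulrDl mul1r lerD //.
exact: le_trans (hB _) Be.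
Qed.

End LpBasis.

Theorem proposition2p6 (R : realType) (p : R) (hp0 : 0 < p) (hp1 : p <= 1)
    (M : Type) (d : M -> M -> R) (hd : is_pmetric p d)
    (N1 N2 : set M) (hN1 : is_net d N1) (hN2 : is_net d N2)
    (hN12 : N1 #= N2) (hdens : card_is_dens d N1)
    (o1 : N1) (o2 : N2)
    (F1 : lmodType R) (NF1 : F1 -> R) (delta1 : N1 -> F1)
    (hF1 : is_lipschitz_free p (subdist d (A := N1)) o1 NF1 delta1)
    (F2 : lmodType R) (NF2 : F2 -> R) (delta2 : N2 -> F2)
    (hF2 : is_lipschitz_free p (subdist d (A := N2)) o2 NF2 delta2) :
  linearly_isomorphic NF1 NF2.
Proof.
have [eps1 e1 sep1] := net_separated hN1.
have [eps2 e2 sep2] := net_separated hN2.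
have hd1 := subdist_pmetric N1 hd; have hd2 := subdist_pmetric N2 hd.
have [c [c' cK c'K]] := card_bijP hN12.
have [finN|infN] := pselect (finite_set [set: N1]).
  have finN2 : finite_set [set: N2].
    by rewrite -(eq_finite_set (card_setT_sym N2)) -(eq_finite_set hN12)
      (eq_finite_set (card_setT_sym N1)).
  have [A hA] := finite_lipschitz c hd1 hd2 e1 sep1 finN.
  have [B hB] := finite_lipschitz c' hd2 hd1 e2 sep2 finN2.
  exact: bilipschitz_free_isomorphic hF1 hF2 cK c'K hA hB.
have infN2 : infinite_set [set: N2].
  by move: infN; rewrite (eq_finite_set (card_setT N1)) (eq_finite_set hN12)
    (eq_finite_set (card_setT N2)).
have [L1 [NL1 [b1 [hL1 iso1]]]] := free_absorb hp0 hd1 e1 sep1 infN hF1.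
have [L2 [NL2 [b2 [hL2 iso2]]]] := free_absorb hp0 hd2 e2 sep2 infN2 hF2.
(* Along N1 #= N2 each l_p basis is indexed by the points of the other net. *)
have hL1' : is_lp_basis p NL1 (b1 \o c') by apply: lp_basis_reindex hL1; exists c.
have hL2' : is_lp_basis p NL2 (b2 \o c) by apply: lp_basis_reindex hL2; exists c'.
have [B1 [g hg]] := net_retraction hN1; have [B2 [h hh]] := net_retraction hN2.
have q1 := pnorm_quasinorm (free_pbanach hF1).1.
have q2 := pnorm_quasinorm (free_pbanach hF2).1.
have ql1 := pnorm_quasinorm (lp_pbanach hL1).1.
have ql2 := pnorm_quasinorm (lp_pbanach hL2).1.
have [K K0 dK] := pmetric_quasi hp0 hd.
have [A1 hA1] := net_retraction_lipschitz hp0 hd e1 sep1 hh.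
have [A2 hA2] := net_retraction_lipschitz hp0 hd e2 sep2 hg.
have hB1 (y : N2) : subdist d y (h (\val (g (\val y)))) <= K * (B1 + B2).
  by apply: le_trans (dK _ _ (\val (g (\val y)))) _; rewrite ler_wpM2l // lerD ?hg ?hh.
have hB2 (x : N1) : subdist d x (g (\val (h (\val x)))) <= K * (B2 + B1).
  by apply: le_trans (dK _ _ (\val (h (\val x)))) _; rewrite ler_wpM2l // lerD ?hg ?hh.
have [T hT] := cross_exists hp0 hd1 e1 sep1 hF1 hF2 hL1' hL2' hA1 hB1.
have [S hS] := cross_exists hp0 hd2 e2 sep2 hF2 hF1 hL2' hL1' hA2 hB2.
have TK := cross_cancel hp0 hF1 hL1' q2 ql2 hT hS.
have SK := cross_cancel hp0 hF2 hL2' q1 ql1 hS hT.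
have [[bT _ _] [bS _ _]] := (hT, hS).
(* F1 ~ F1 x L1 ~ F2 x L2 ~ F2 *)
apply: (linearly_isomorphic_trans q1 (prod_norm_quasinorm q1 ql1) q2 iso1).
apply: (linearly_isomorphic_trans (prod_norm_quasinorm q1 ql1)
  (prod_norm_quasinorm q2 ql2) q2 _ (linearly_isomorphic_sym iso2)).
exact: linearly_isomorphicI bT bS TK SK.
Qed.
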